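(* Let $F:\mathbb{R}^d\to\mathbb{R}$ satisfy $F\in\mathbb{C}_L^1$ and $F^*=\inf_x F(x)>-\infty$. Let $x_0\in\mathbb{R}^d$, $b_0>0$, $\eta>0$, and let $(x_j)_{j\ge 0}$, $(b_j)_{j\ge 0}$ be generated by AdaGrad-Norm: for $j=1,2,\ldots$, $$G_{j-1}=G(x_{j-1},\xi_{j-1}),\qquad b_j^2=b_{j-1}^2+\|G_{j-1}\|^2,\qquad x_j=x_{j-1}-\frac{\eta}{b_j}G_{j-1},$$ with $b_j>0$. Suppose that for each $k\ge 0$, $\mathbb{E}_{\xi_k}[G(x_k,\xi_k)]=\nabla F(x_k)$, and that 1. the random vectors $\xi_k$, $k=0,1,2,\ldots$, are independent of each other and also of $x_k$; 2. $\mathbb{E}_{\xi_k}\big[\|G(x_k,\xi_k)-\nabla F(x_k)\|^2\big]\le\sigma^2$ for each $k\ge 0$; 3. $\|\nabla F(x)\|^2\le\gamma^2$ for all $x\in\mathbb{R}^d$, where $\sigma,\gamma\ge 0$ are constants. Then for every integer $N\ge 1$ and every $\delta\in(0,1)$, with probability at least $1-\delta$, $$\min_{\ell\in\{0,1,\ldots,N-1\}}\|\nabla F(x_\ell)\|^2\le\min\left\{\left(\frac{2b_0}{N}+\frac{4(\gamma+\sigma)}{\sqrt N}\right)\frac{\mathcal{Q}}{\delta^{3/2}},\ \left(\frac{8\mathcal{Q}}{\delta}+2b_0\right)\frac{4\mathcal{Q}}{N\delta}+\frac{8\mathcal{Q}\sigma}{\delta^{3/2}\sqrt N}\right\},$$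 where $$\mathcal{Q}=\frac{F(x_0)-F^*}{\eta}+\frac{4\sigma+\eta L}{2}\log\left(\frac{20N(\gamma^2+\sigma^2)}{b_0^2}+10\right).$$
   Context: $\|\cdot\|$ is the $\ell_2$ norm. $F\in\mathbb{C}_L^1$ means that $F$ is differentiable with $L$-Lipschitz gradient, i.e. $\|\nabla F(x)-\nabla F(y)\|\le L\|x-y\|$ for all $x,y\in\mathbb{R}^d$, where $L>0$ is the smallest such number. The initial point $x_0$ is deterministic. $G(x_k,\xi_k)$ is a stochastic gradient observed at iteration $k$, where $\xi_k$ is a random vector. $\mathbb{E}_{\xi_k}[\cdot]$ denotes expectation with respect to $\xi_k$ conditional on $\xi_0,\xi_1,\ldots,\xi_{k-1}$. *)

(* Defs.v *)
From HB Require Import structures.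
From mathcomp Require Import all_boot all_order all_algebra.
From mathcomp Require Import all_classical all_reals all_analysis.

Set Implicit Arguments.
Unset Strict Implicit.
Unset Printing Implicit Defensive.

Import Order.TTheory GRing.Theory Num.Theory.
Import numFieldNormedType.Exports.

Local Open Scope classical_set_scope.
Local Open Scope ring_scope.

(* The sigma-algebra on R^d generated by the coordinate projections, i.e. the
   Borel sigma-algebra (same construction as the library's on n.-tuple). *)
Section rV_measurable.
Context {R : realType} {d : nat}.

Let coord (i : 'I_d) (v : 'rV[R]_d) : R := v ord0 i.

Let rV_set0 : g_sigma_preimage coord set0.
Proof. exact: sigma_algebra0. Qed.

Let rV_setC A : g_sigma_preimage coord A -> g_sigma_preimage coord (~` A).
Proof. exact: sigma_algebraC. Qed.

Let rV_bigcup (A : (set 'rV[R]_d)^nat) : (forall i, g_sigma_preimage coord (A i)) ->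
  g_sigma_preimage coord (\bigcup_i A i).
Proof. exact: sigma_algebra_bigcup. Qed.

HB.instance Definition _ := @isMeasurable.Build default_measure_display
  'rV[R]_d (g_sigma_preimage coord) rV_set0 rV_setC rV_bigcup.

End rV_measurable.

(* The library's norm `|v| on 'rV[R]_d is the sup norm, hence this definition. *)
Definition l2norm {R : realType} {d : nat} (v : 'rV[R]_d) : R :=
  Num.sqrt (\sum_(i < d) v ord0 i ^+ 2).

Definition gradient {R : realType} {d : nat} (F : 'rV[R]_d -> R) (x : 'rV[R]_d) :
    'rV[R]_d :=
  \row_(i < d) 'D_(delta_mx ord0 i) F x.

Definition grad_lipschitz {R : realType} {d : nat} (F : 'rV[R]_d -> R) (M : R) : Prop :=
  forall x y, l2norm (gradient F x - gradient F y) <= M * l2norm (x - y).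

Definition C1L {R : realType} {d : nat} (L : R) (F : 'rV[R]_d -> R) : Prop :=
  [/\ forall x, differentiable F x,
      0 < L,
      grad_lipschitz F L &
      forall M, 0 < M -> grad_lipschitz F M -> L <= M].

Section probability_notions.
Local Open Scope ereal_scope.
Context {disp : measure_display} {T : measurableType disp} {R : realType}.
Variable P : probability T R.

Definition mutually_independent {disp' : measure_display} {E : measurableType disp'}
    (X : nat -> T -> E) : Prop :=
  forall (s : seq nat) (A : nat -> set E), uniq s ->
    (forall i, measurable (A i)) ->
    P (\bigcap_(i in [set` s]) (X i @^-1` A i)) =
    \prod_(i <- s) P (X i @^-1` A i).

Definition independent {disp1 disp2 : measure_display} {E1 : measurableType disp1}
    {E2 : measurableType disp2} (X : T -> E1) (Y : T -> E2) : Prop :=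
  forall (A : set E1) (B : set E2), measurable A -> measurable B ->
    P ((X @^-1` A) `&` (Y @^-1` B)) = P (X @^-1` A) * P (Y @^-1` B).

(* sigma(X_0, ..., X_{k-1}); the trivial sigma-algebra for k = 0. *)
Definition past {disp' : measure_display} {E : measurableType disp'}
    (X : nat -> T -> E) (k : nat) : set (set T) :=
  <<s \bigcup_(i in `I_k) preimage_set_system setT (X i) measurable >>.

(* Y is a version of E[X | S], for a sub-sigma-algebra S of the measurable sets. *)
Definition is_cond_exp (S : set (set T)) (X Y : T -> R) : Prop :=
  [/\ P.-integrable setT (EFin \o X),
      P.-integrable setT (EFin \o Y),
      forall B : set R, measurable B -> S (Y @^-1` B) &
      forall A, S A -> \int[P]_(w in A) (X w)%:E = \int[P]_(w in A) (Y w)%:E].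

Definition is_cond_exp_rV {d : nat} (S : set (set T)) (X Y : T -> 'rV[R]_d) : Prop :=
  forall i, is_cond_exp S (fun w => X w ord0 i) (fun w => Y w ord0 i).

Definition cond_exp_le (S : set (set T)) (X : T -> R) (c : R) : Prop :=
  exists2 Y, is_cond_exp S X Y & {ae P, forall w, (Y w <= c)%R}.

End probability_notions.

Definition adagrad_norm {T : Type} {R : realType} {d m : nat}
    (G : 'rV[R]_d -> 'rV[R]_m -> 'rV[R]_d) (eta : R) (x0 : 'rV[R]_d) (b0 : R)
    (xi : nat -> T -> 'rV[R]_m) (x : nat -> T -> 'rV[R]_d) (b : nat -> T -> R) : Prop :=
  forall w : T,
  [/\ x 0%N w = x0,
      b 0%N w = b0,
      forall j, 0 < b j.+1 w,
      forall j, b j.+1 w ^+ 2 = b j w ^+ 2 + l2norm (G (x j w) (xi j w)) ^+ 2 &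
      forall j, x j.+1 w = x j w - (eta / b j.+1 w) *: G (x j w) (xi j w)].

Definition calQ {R : realType} (Fx0 Fstar eta L sigma gamma b0 : R) (N : nat) : R :=
  (Fx0 - Fstar) / eta
  + (4 * sigma + eta * L) / 2
    * ln (20 * N%:R * (gamma ^+ 2 + sigma ^+ 2) / b0 ^+ 2 + 10).

(* Main.v *)
Require Import Defs.
From HB Require Import structures.
From mathcomp Require Import all_boot all_order all_algebra.
From mathcomp Require Import all_classical all_reals all_analysis.
From mathcomp Require Import measurable_realfun ring lra.

(* With S_k = sqrt (b_k^2 + |grad F(x_k)|^2 + sigma^2), which is determined by
   the past, the step 1 / b_(k+1) is replaced by 1 / S_k in the descent
   inequality; the error is absorbed using AM-GM and |b_(k+1) - S_k| <=
   |G_k - grad F(x_k)| + sigma. The inequality is telescoped pathwise, so that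
   F never has to be integrated, and sum_k |G_k|^2 / b_(k+1)^2 <=
   ln (b_N^2 / b_0^2), whose mean is controlled by a tangent line of ln. Taking
   expectations gives E X <= Q for X = sum_k |grad F(x_k)|^2 / (2 S_k).
   If S_k^2 <= V for all k < N, then sum_k |grad F(x_k)|^2 <= 2 X sqrt V. Both
   rates follow from this, with V = b_0^2 + 2 N gamma^2 + W and
   V = b_0^2 + 2 sum_k |grad F(x_k)|^2 + W respectively, where
   W = 2 sum_(k < N - 1) |G_k - grad F(x_k)|^2 + sigma^2 has mean at most
   2 N sigma^2, by a single use of Markov's inequality on a positive combination
   of X and W. *)

Set Implicit Arguments.
Unset Strict Implicit.
Unset Printing Implicit Defensive.

Import Order.TTheory GRing.Theory Num.Theory.
Import numFieldNormedType.Exports.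

Local Open Scope classical_set_scope.
Local Open Scope ring_scope.

(** * Euclidean geometry and the descent inequality *)

Definition dotp {R : realType} {d : nat} (u v : 'rV[R]_d) : R :=
  \sum_(i < d) u ord0 i * v ord0 i.

Section euclidean.
Context {R : realType} {d : nat}.
Implicit Types u v w : 'rV[R]_d.

Lemma dotpC u v : dotp u v = dotp v u.
Proof. by apply: eq_bigr => i _; rewrite mulrC. Qed.

Lemma dotpDr u v w : dotp u (v + w) = dotp u v + dotp u w.
Proof. by rewrite -big_split/=; apply: eq_bigr => i _; rewrite mxE mulrDr. Qed.

Lemma dotpZr u (a : R) v : dotp u (a *: v) = a * dotp u v.
Proof. by rewrite mulr_sumr; apply: eq_bigr => i _; rewrite mxE mulrCA. Qed.

Lemma dotpZl (a : R) u v : dotp (a *: u) v = a * dotp u v.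
Proof. by rewrite dotpC dotpZr dotpC. Qed.

Lemma dotpBr u v w : dotp u (v - w) = dotp u v - dotp u w.
Proof. by rewrite dotpDr -scaleN1r dotpZr mulN1r. Qed.

Lemma dotpBl u v w : dotp (u - v) w = dotp u w - dotp v w.
Proof. by rewrite dotpC dotpBr !(dotpC w). Qed.

Lemma dotp_ge0 u : 0 <= dotp u u.
Proof. by apply: sumr_ge0 => i _; rewrite -expr2 sqr_ge0. Qed.

Lemma l2norm_ge0 u : 0 <= l2norm u.
Proof. exact: sqrtr_ge0. Qed.

Lemma l2norm_sqr u : l2norm u ^+ 2 = dotp u u.
Proof.
rewrite sqr_sqrtr; last by apply: sumr_ge0 => i _; rewrite sqr_ge0.
by apply: eq_bigr => i _; rewrite expr2.
Qed.

Lemma l2normZ (a : R) u : l2norm (a *: u) = `|a| * l2norm u.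
Proof.
apply/eqP; rewrite -(@eqrXn2 _ 2)// ?mulr_ge0 ?l2norm_ge0//.
by rewrite exprMn !l2norm_sqr dotpZl dotpZr mulrA -expr2 -normrX ger0_norm ?sqr_ge0.
Qed.

Lemma coord_le_l2norm u i : `|u ord0 i| <= l2norm u.
Proof.
rewrite -ler_sqr ?nnegrE ?l2norm_ge0// l2norm_sqr -normrX.
rewrite ger0_norm ?sqr_ge0// /dotp (bigD1 i)//= -expr2 lerDl.
by apply: sumr_ge0 => j _; rewrite -expr2 sqr_ge0.
Qed.

(** Cauchy-Schwarz: expanding the square of [l2norm v *: u - l2norm u *: v] gives the claim
    multiplied by [2 * l2norm u * l2norm v], so vanishing norms are treated apart. *)
Lemma dotp_le u v : dotp u v <= l2norm u * l2norm v.
Proof.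
have := dotp_ge0 (l2norm v *: u - l2norm u *: v).
rewrite dotpBr !dotpBl !dotpZl !dotpZr -!l2norm_sqr (dotpC v u).
have [u0 v0] : 0 <= l2norm u /\ 0 <= l2norm v by rewrite !l2norm_ge0.
have zero (w w' : 'rV[R]_d) : l2norm w = 0 -> dotp w w' = 0.
  move=> w0; rewrite /dotp big1// => i _.
  have := coord_le_l2norm w i; rewrite w0 normr_le0 => /eqP ->.
  by rewrite mul0r.
have [/zero ->|u1] := eqVneq (l2norm u) 0; first by rewrite mulr_ge0.
have [/zero H|v1] := eqVneq (l2norm v) 0; first by rewrite dotpC H mulr_ge0.
have uv : 0 < l2norm u * l2norm v by rewrite mulr_gt0 ?lt0r ?u1 ?v1.
move=> H; rewrite -(ler_pM2l uv); lra.
Qed.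

Lemma normr_dotp_le u v : `|dotp u v| <= l2norm u * l2norm v.
Proof.
rewrite ler_norml dotp_le andbT lerNl.
have := dotp_le (-1 *: u) v.
by rewrite dotpZl l2normZ normrN1 mul1r mulN1r.
Qed.

Lemma l2norm_sqrB u v :
  l2norm u ^+ 2 = l2norm v ^+ 2 + 2 * dotp v (u - v) + l2norm (u - v) ^+ 2.
Proof. by rewrite !l2norm_sqr !dotpBl !dotpBr (dotpC v u); lra. Qed.

Lemma l2norm_le_add u v : l2norm u <= l2norm v + l2norm (u - v).
Proof.
rewrite -ler_sqr ?nnegrE ?addr_ge0 ?l2norm_ge0//.
by rewrite (l2norm_sqrB u v); have := dotp_le v (u - v); nra.
Qed.

(** Factor the difference of squares and apply the reverse triangle inequality. *)
Lemma l2norm_sqr_dist u v :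
  `|l2norm u ^+ 2 - l2norm v ^+ 2| <= l2norm (u - v) * (l2norm u + l2norm v).
Proof.
rewrite subr_sqr normrM [`|_ + l2norm v|]ger0_norm ?addr_ge0 ?l2norm_ge0//.
apply: ler_wpM2r; first by rewrite addr_ge0 ?l2norm_ge0.
rewrite ler_norml lerBlDl l2norm_le_add andbT.
have := l2norm_le_add v u; have -> : l2norm (v - u) = l2norm (u - v).
  by rewrite -opprB -scaleN1r l2normZ normrN1 mul1r.
lra.
Qed.

Lemma l2norm_sqr_le2 u v :
  l2norm u ^+ 2 <= 2 * l2norm v ^+ 2 + 2 * l2norm (u - v) ^+ 2.
Proof.
rewrite (l2norm_sqrB u v); have := dotp_le v (u - v).
have := sqr_ge0 (l2norm v - l2norm (u - v)); lra.
Qed.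

End euclidean.

(** * The descent inequality for a Lipschitz gradient *)

Section descent.
Context {R : realType} {d : nat}.
Variables (F : 'rV[R]_d -> R) (L : R).
Hypothesis dF : forall x, differentiable F x.

Lemma diff_gradient x v : 'd F x v = dotp (gradient F x) v.
Proof.
rewrite [v in LHS]row_sum_delta linear_sum; apply: eq_bigr => i _.
by rewrite linearZ/= mxE deriveE// mulrC.
Qed.

Lemma is_derive_line x v (t : R) :
  is_derive t 1 (fun s : R => F (x + s *: v)) (dotp (gradient F (x + t *: v)) v).
Proof.
pose h := fun s : R => x + s *: v.
have dh : is_diff t h ( *:%R^~ v).
  have := is_diffD (is_diff_cst x t) (is_diff_scalel t v).
  by rewrite add0r.
have dfh : differentiable (F \o h) t by apply: differentiable_comp.
apply: DeriveDef; first exact/derivable1_diffP.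
rewrite deriveE// diff_comp//= diff_val/= scale1r.
exact: diff_gradient.
Qed.

(** Mean value theorem for [phi], which is F along the segment minus its linear and quadratic model.
    The Lipschitz bound and Cauchy-Schwarz make [dphi] nonpositive on ]0, 1[. *)
Lemma grad_lipschitz_descent x v : grad_lipschitz F L ->
  F (x + v) <= F x + dotp (gradient F x) v + L / 2 * l2norm v ^+ 2.
Proof.
move=> hL.
pose c := dotp (gradient F x) v; pose K := L / 2 * l2norm v ^+ 2.
pose phi := fun t : R => F (x + t *: v) - c * t - K * t ^+ 2.
pose dphi := fun t : R => dotp (gradient F (x + t *: v)) v - c - K * (2 * t).
have hphi (t : R) : is_derive t 1 phi (dphi t).
  have h1 := is_derive_line x v t.
  have h2 : is_derive t 1 (fun t : R => c * t + K * t ^+ 2) (c + K * (2 * t)).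
    apply: is_derive_eq; rewrite /GRing.scale/=; ring.
  have -> : phi = (fun s : R => F (x + s *: v)) - (fun t : R => c * t + K * t ^+ 2).
    by apply/funext => s; rewrite /phi !fctE; ring.
  by apply: is_derive_eq; rewrite /dphi; ring.
have [t t01] : exists2 t, t \in `]0, 1[%R & phi 1 - phi 0 = dphi t * (1 - 0).
  apply: MVT => //.
  apply: derivable_within_continuous => s _; exact: ex_derive.
rewrite subr0 mulr1 /phi scale1r scale0r addr0 expr0n/= expr1n !mulr0 !mulr1 !subr0.
move=> phiE.
have : dphi t <= 0.
  move: t01; rewrite in_itv/= => /andP[t0 _].
  rewrite /dphi /c -dotpBl.
  have := dotp_le (gradient F (x + t *: v) - gradient F x) v.
  have := hL (x + t *: v) x.
  rewrite addrAC subrr add0r l2normZ (gtr0_norm t0) /K => h1 h2.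
  have := ler_wpM2r (l2norm_ge0 v) h1; nra.
by rewrite -phiE /c /K; lra.
Qed.

End descent.

(** * Orthogonality to a sub-sigma-algebra *)

Section layer_cake.
Context {R : realType}.

(** The sum counts the integers from 1 to n that do not exceed y. With [layer_sum_ge] it lies within
    1 of y whenever 0 <= y <= n. *)
Lemma layer_sum_le (n : nat) (y : R) : 0 <= y ->
  \sum_(i < n) (i.+1%:R <= y)%R%:R <= y.
Proof.
elim: n => [|n IH] y0; first by rewrite big_ord0.
rewrite big_ord_recr/=; case: (leP n.+1%:R y) => h/=; last by rewrite addr0 IH.
apply: le_trans h; rewrite -[n.+1]addn1 natrD lerD2r.
have -> : n%:R = \sum_(i < n) 1 :> R by rewrite sumr_const card_ord.
by apply: ler_sum => i _; rewrite lern1 leq_b1.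
Qed.

Lemma layer_sum_ge (n : nat) (y : R) : y <= n%:R ->
  y <= \sum_(i < n) (i.+1%:R <= y)%R%:R + 1.
Proof.
elim: n => [|n IH] yn; first by rewrite big_ord0 add0r (le_trans yn).
rewrite big_ord_recr/=; have [h|h] := leP y n%:R.
  by apply: (le_trans (IH h)); rewrite lerD2r lerDl.
rewrite (eq_bigr (fun=> 1)); last first.
  move=> i _; rewrite (_ : _ <= _)%R//; apply: le_trans (ltW h).
  by rewrite ler_nat.
rewrite sumr_const card_ord; apply: (le_trans yn).
by rewrite -[n.+1]addn1 natrD -addrA lerD2l lerDr.
Qed.

End layer_cake.

Section pull_out.
Context {disp : measure_display} {T : measurableType disp} {R : realType}.
Variable P : probability T R.

Lemma integrable_bounded_mul (Z D : T -> R) : measurable_fun setT Z ->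
  (forall w, `|Z w| <= 1) -> P.-integrable setT (EFin \o D) ->
  P.-integrable setT (EFin \o (fun w => Z w * D w)).
Proof.
move=> mZ Z1 iD; apply: (le_integrable _ _ _ iD) => //.
  apply/measurable_EFinP; apply: measurable_funM => //.
  by apply/measurable_EFinP; exact: measurable_int iD.
move=> w _ /=; rewrite lee_fin normrM -[leRHS]mul1r.
by rewrite ler_wpM2r.
Qed.

(* It suffices to treat multiples of indicators because Z is uniformly
   approximated by the layer sums n^-1 * \sum_(i < n) [i.+1 <= n * Z]. *)
Lemma Rintegral_orthogonal01 (S : set (set T)) (Z D : T -> R) :
  S `<=` measurable -> measurable_fun setT Z ->
  (forall t, S [set w | t <= Z w]) -> (forall w, 0 <= Z w <= 1) ->
  P.-integrable setT (EFin \o D) ->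
  (forall A, S A -> \int[P]_(w in A) D w = 0) ->
  \int[P]_w (Z w * D w) = 0.
Proof.
move=> Sm mZ SZ Z01 iD D0.
pose I := \int[P]_w `|D w|.
have iZD : P.-integrable setT (EFin \o (fun w => Z w * D w)).
  apply: integrable_bounded_mul => // w.
  by have /andP[z0 z1] := Z01 w; rewrite ger0_norm.
(* [Zn] combines indicators of sets of S, hence is orthogonal to D, and it differs from Z by at most
   [n.+1%:R^-1]. Letting n grow makes the integral vanish. *)
have key (n : nat) : `|\int[P]_w (Z w * D w)| <= n.+1%:R^-1 * I.
  pose A i := [set w | i.+1%:R <= n.+1%:R * Z w].
  have SA i : S (A i).
    have -> : A i = [set w | i.+1%:R / n.+1%:R <= Z w].
      by apply/seteqP; split => w /=; rewrite ler_pdivrMr ?ltr0n// mulrC.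
    exact: SZ.
  pose Zn w : R := n.+1%:R^-1 * \sum_(i < n.+1) (i.+1%:R <= n.+1%:R * Z w)%R%:R.
  have n0 : 0 < n.+1%:R :> R by rewrite ltr0n.
  have ZnE w : Zn w * D w =
      n.+1%:R^-1 * \sum_(i < n.+1) (D \_ (A i)) w.
    rewrite -mulrA mulr_suml; congr (_ * _); apply: eq_bigr => i _.
    rewrite patchE; case: ifPn => [|/negP] h.
      by rewrite (_ : (_ <= _) = true) ?mul1r//; move: h; rewrite inE.
    by rewrite (_ : (_ <= _) = false) ?mul0r//; apply/negP => h'; apply: h; rewrite inE.
  have ZZn w : 0 <= Z w - Zn w <= n.+1%:R^-1.
    have /andP[z0 z1] := Z01 w.
    have y0 : 0 <= n.+1%:R * Z w by rewrite mulr_ge0.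
    have y1 : n.+1%:R * Z w <= n.+1%:R by rewrite ler_piMr.
    have := layer_sum_le n.+1 y0; have := layer_sum_ge y1.
    rewrite /Zn; set s := \sum_(_ < _) _ => h1 h2.
    rewrite (_ : Z w - _ = n.+1%:R^-1 * (n.+1%:R * Z w - s)); last first.
      by rewrite mulrBr mulKf ?gt_eqF.
    rewrite mulr_ge0 ?invr_ge0// ?subr_ge0//=.
    by rewrite ler_piMr ?invr_ge0// lerBlDr addrC.
  have iA i : P.-integrable setT (EFin \o (D \_ (A i))).
    have mA : measurable (A i) by exact: Sm.
    rewrite -restrict_EFin; apply/integrable_restrict => //.
    by rewrite setTI; apply: integrableS iD.
  have isum : P.-integrable setT
      (EFin \o (fun w => \sum_(i < n.+1) (D \_ (A i)) w)).
    rewrite (_ : _ \o _ = fun w => (\sum_(i < n.+1) (EFin \o (D \_ (A i))) w)%E).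
      exact: integrable_sum.
    by apply/funext => w; rewrite /= sumEFin.
  have iZn : P.-integrable setT (EFin \o (fun w => Zn w * D w)).
    rewrite (_ : _ \o _ = fun w => ((n.+1%:R^-1)%:E *
       (EFin \o (fun w => \sum_(i < n.+1) (D \_ (A i)) w)%R) w)%E).
      exact: integrableZl.
    by apply/funext => w; rewrite /= ZnE.
  have Zn0 : \int[P]_w (Zn w * D w) = 0.
    under eq_Rintegral do rewrite ZnE.
    rewrite RintegralZl// (_ : Rintegral _ _ _ = 0) ?mulr0//.
    rewrite /Rintegral; under eq_integral do rewrite -sumEFin.
    rewrite integral_sum//=; last by move=> i; exact: iA.
    rewrite big1//= => i _.
    rewrite -[LHS]fineK; last exact: integrable_fin_num (iA i).
    have := D0 _ (SA i); rewrite Rintegral_mkcond /Rintegral => ->//.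
  have iB : P.-integrable setT (EFin \o (fun w => (Z w - Zn w) * D w)).
    rewrite (_ : _ \o _ = (EFin \o (fun w => Z w * D w)%R) \-
                          (EFin \o (fun w => Zn w * D w)%R))%E.
      exact: integrableB.
    by apply/funext => w /=; rewrite mulrBl EFinB.
  rewrite -[X in `|X|]subr0 -Zn0 -RintegralB//.
  under eq_Rintegral do rewrite -mulrBl.
  apply: (le_trans (le_normr_Rintegral _ _)) => //.
  rewrite /I -RintegralZl//; last exact: integrable_norm.
  apply: le_Rintegral => //.
  - exact: integrable_norm.
  - rewrite (_ : _ \o _ = fun w => ((n.+1%:R^-1)%:E * (`|D w|)%:E)%E).
      by apply: integrableZl => //; exact: integrable_norm.
    by apply/funext => w.
  - move=> w _; rewrite normrM ler_wpM2r//.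
    by have /andP[? ?] := ZZn w; rewrite ger0_norm.
apply/eqP; rewrite -normr_le0; apply/ler_addgt0Pl => e e0; rewrite addr0.
have I0 : 0 <= I by exact: Rintegral_ge0.
have := archimedean.Num.Theory.archi_boundP (divr_ge0 I0 (ltW e0)).
set n := archimedean.Num.bound _ => nI.
apply: (le_trans (key n)); rewrite mulrC ler_pdivrMr ?ltr0n//.
rewrite -ler_pdivrMl// mulrC (le_trans (ltW nI))// ler_nat//.
Qed.

(** The affine map z -> (z + 1) / 2 reduces the range [-1, 1] to [0, 1]; the constant it introduces
    is harmless because D has mean zero, S containing the whole space. *)
Lemma Rintegral_orthogonal (S : set (set T)) (Z D : T -> R) :
  S setT -> S `<=` measurable -> measurable_fun setT Z ->
  (forall t, S [set w | t <= Z w]) -> (forall w, `|Z w| <= 1) ->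
  P.-integrable setT (EFin \o D) ->
  (forall A, S A -> \int[P]_(w in A) D w = 0) ->
  \int[P]_w (Z w * D w) = 0.
Proof.
move=> ST Sm mZ SZ Z1 iD D0.
pose Z' w := 2^-1 * (Z w + 1).
have mZ' : measurable_fun setT Z'.
  by apply: measurable_funM => //; apply: measurable_funD.
have Z'01 w : 0 <= Z' w <= 1.
  by have := Z1 w; rewrite /Z' ler_norml => /andP[h1 h2]; lra.
have h : \int[P]_w (Z' w * D w) = 0.
  apply: (Rintegral_orthogonal01 Sm mZ') => // t.
  rewrite (_ : mkset _ = [set w | 2 * t - 1 <= Z w]); first exact: SZ.
  by apply/seteqP; split => w; rewrite /= /Z' => ?; lra.
have iZ' : P.-integrable setT (EFin \o (fun w => Z' w * D w)).
  apply: integrable_bounded_mul => // w.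
  by have /andP[z0 z1] := Z'01 w; rewrite ger0_norm.
have -> : \int[P]_w (Z w * D w) = \int[P]_w (2 * (Z' w * D w) - D w).
  by apply: eq_Rintegral => w _; rewrite /Z'; field.
rewrite RintegralB//; last first.
  rewrite (_ : _ \o _ = fun w => (2%:E * (Z' w * D w)%:E)%E); last exact/funext.
  exact: integrableZl.
by rewrite RintegralZl// h D0// mulr0 subrr.
Qed.

End pull_out.

(** * Measurability with respect to the past *)

Section measurable_operations.
Context {disp : measure_display} {T : measurableType disp} {R : realType}.

Lemma measurable_coord d (i : 'I_d) :
  measurable_fun setT (fun v : 'rV[R]_d => v ord0 i).
Proof.
move=> _ Y mY; rewrite setTI; apply: sub_sigma_algebra => /=.
rewrite -bigcup_seq/=; exists i => /=; first by rewrite mem_index_enum.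
by exists Y => //; rewrite setTI.
Qed.

(** The sets pulled back by f form the sigma-algebra generated by the coordinates of f, so it
    suffices to look at those. *)
Lemma measurable_fun_rV d (f : T -> 'rV[R]_d) :
  (forall i, measurable_fun setT (fun w => f w ord0 i)) -> measurable_fun setT f.
Proof.
move=> mf.
suff : g_sigma_preimage (fun i => (fun v : 'rV[R]_d => v ord0 i) \o f) `<=` measurable.
  by rewrite g_sigma_preimage_comp => prefS _ A mA; apply: prefS; exists A.
apply: smallest_sub; first exact: sigma_algebra_measurable.
by rewrite -bigcup_seq/=; apply: bigcup_sub => i _ _ [B mB <-]; exact: mf.
Qed.

Lemma measurable_fun_sqrt (f : T -> R) :
  measurable_fun setT f -> measurable_fun setT (fun w => Num.sqrt (f w)).
Proof.
move=> mf; apply: (measurableT_comp _ mf).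
apply: continuous_measurable_fun; exact: sqrt_continuous.
Qed.

Lemma measurable_fun_inv_gt0 (f : T -> R) : (forall w, 0 < f w) ->
  measurable_fun setT f -> measurable_fun setT (fun w => (f w)^-1).
Proof.
move=> f0 mf.
rewrite (_ : (fun _ => _) = (fun w => expR (- ln (f w)))); last first.
  by apply/funext => w; rewrite expRN lnK ?posrE.
apply: measurableT_comp => //; apply: measurable_funN.
exact: measurableT_comp.
Qed.

Lemma measurable_fun_l2norm_sqr d (f : T -> 'rV[R]_d) :
  (forall i, measurable_fun setT (fun w => f w ord0 i)) ->
  measurable_fun setT (fun w => l2norm (f w) ^+ 2).
Proof.
move=> mf; under eq_fun do rewrite l2norm_sqr.
by apply: measurable_sum => i; exact: measurable_funM.
Qed.

End measurable_operations.

(** Phrased for a bare family of sets, as [past] is one; [measurable_wrtP] passes to the measurable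
    structure it generates, where closure under arithmetic operations is at hand. *)
Definition measurable_wrt {T : Type} {disp' : measure_display}
    {E : measurableType disp'} (S : set (set T)) (f : T -> E) : Prop :=
  forall B, measurable B -> S (f @^-1` B).

Lemma measurable_wrtP {T : pointedType} {disp' : measure_display}
    {E : measurableType disp'} (G : set (set T)) (f : T -> E) :
  measurable_wrt <<s G >> f <->
  measurable_fun (setT : set (g_sigma_algebraType G)) f.
Proof.
split=> [mf _ B mB|mf B mB]; first by rewrite setTI; exact: mf.
by have := mf measurableT B mB; rewrite setTI.
Qed.

Lemma measurable_wrt_l2norm_sqr {T : pointedType} {R : realType} {d : nat}
    (G : set (set T)) (f : T -> 'rV[R]_d) :
  (forall i, measurable_wrt <<s G >> (fun w => f w ord0 i)) ->
  measurable_wrt <<s G >> (fun w => l2norm (f w) ^+ 2).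
Proof.
move=> mf; apply/measurable_wrtP.
apply: (measurable_fun_l2norm_sqr (T := g_sigma_algebraType G) (f := f)) => i.
exact/measurable_wrtP.
Qed.

Section past_measurable.
Context {disp : measure_display} {T : measurableType disp}.
Context {disp' : measure_display} {E : measurableType disp'}.
Variable X : nat -> T -> E.

Lemma past_sub_measurable k : (forall i, measurable_fun setT (X i)) ->
  past X k `<=` measurable.
Proof.
move=> mX; apply: smallest_sub; first exact: sigma_algebra_measurable.
by apply: bigcup_sub => i _ _ [B mB <-]; exact: mX.
Qed.

Lemma past_mono k : past X k `<=` past X k.+1.
Proof.
apply: sub_sigma_algebra2; apply: bigcup_sub => i ik.
by apply: (@bigcup_sup _ _ i); exact: ltnW.
Qed.

Lemma past_last k : measurable_wrt (past X k.+1) (X k).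
Proof.
move=> B mB; apply: sub_sigma_algebra; exists k; first exact: ltnSn.
by exists B => //; rewrite setTI.
Qed.

End past_measurable.

Section adagrad_measurable.
Context {disp : measure_display} {T : measurableType disp} {R : realType} {d m : nat}.
Variables (G : 'rV[R]_d -> 'rV[R]_m -> 'rV[R]_d) (eta : R) (x0 : 'rV[R]_d) (b0 : R).
Variables (xi : nat -> T -> 'rV[R]_m) (x : nat -> T -> 'rV[R]_d) (b : nat -> T -> R).
Hypothesis mG : measurable_fun setT (fun z : 'rV[R]_d * 'rV[R]_m => G z.1 z.2).
Hypothesis hxb : adagrad_norm G eta x0 b0 xi x b.

(** The process is adapted: by induction, the new state is a measurable function of the previous
    state and of [xi k], all known to [past xi k.+1]. *)
Lemma adagrad_measurable k :
  measurable_wrt (past xi k) (x k) /\ measurable_wrt (past xi k) (b k).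
Proof.
elim: k => [|k [IHx IHb]].
  have -> : x 0%N = cst x0 by apply/funext => w; case: (hxb w).
  have -> : b 0%N = cst b0 by apply/funext => w; case: (hxb w).
  by split; apply/measurable_wrtP; exact: measurable_cst.
have mxi := @past_last _ T _ _ xi k.
have mx : measurable_wrt (past xi k.+1) (x k).
  by move=> B mB; apply: past_mono; exact: IHx.
have mb : measurable_wrt (past xi k.+1) (b k).
  by move=> B mB; apply: past_mono; exact: IHb.
move: mxi mx mb => /measurable_wrtP mxi /measurable_wrtP mx /measurable_wrtP mb.
pose GG w := G (x k w) (xi k w).
have mGG := measurableT_comp mG (measurable_fun_pair mx mxi).
have mGi i := measurableT_comp (@measurable_coord R d i) mGG.
have mb' : measurable_wrt (past xi k.+1) (b k.+1).
  apply/measurable_wrtP.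
  (* The recursion only prescribes the square; positivity recovers [b k.+1] as the square root. *)
  have -> : b k.+1 = fun w => Num.sqrt (b k w ^+ 2 + l2norm (GG w) ^+ 2).
    apply/funext => w; have [_ _ bpos bE _] := hxb w.
    by rewrite -bE sqrtr_sqr ger0_norm// ltW.
  apply: measurable_fun_sqrt; apply: measurable_funD.
    exact: measurable_funX.
  exact: measurable_fun_l2norm_sqr.
split=> //; move/measurable_wrtP in mb'.
apply/measurable_wrtP; apply: measurable_fun_rV => i.
have -> : (fun w => x k.+1 w ord0 i) =
    fun w => x k w ord0 i - eta * (b k.+1 w)^-1 * GG w ord0 i.
  by apply/funext => w; have [_ _ _ _ ->] := hxb w; rewrite !mxE.
apply: measurable_funB; first exact: measurableT_comp (@measurable_coord R d i) mx.
apply: measurable_funM; last exact: mGi.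
apply: measurable_funM => //.
apply: measurable_fun_inv_gt0 => // w.
by case: (hxb w).
Qed.

End adagrad_measurable.

(** * Conditional expectations *)

Section real_valued_integrals.
Context {disp : measure_display} {T : measurableType disp} {R : realType}.
Variable P : probability T R.

Lemma integrable_cstR (c : R) : P.-integrable setT (EFin \o (fun=> c)).
Proof. exact: finite_measure_integrable_cst. Qed.

Lemma integrableDR (f g : T -> R) : P.-integrable setT (EFin \o f) ->
  P.-integrable setT (EFin \o g) ->
  P.-integrable setT (EFin \o (fun w => f w + g w)).
Proof. by move=> hf hg; exact: (integrableD measurableT hf hg). Qed.

Lemma integrableZR (c : R) (f : T -> R) : P.-integrable setT (EFin \o f) ->
  P.-integrable setT (EFin \o (fun w => c * f w)).
Proof. by move=> hf; exact: (integrableZl measurableT c hf). Qed.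

Lemma integrableBR (f g : T -> R) : P.-integrable setT (EFin \o f) ->
  P.-integrable setT (EFin \o g) ->
  P.-integrable setT (EFin \o (fun w => f w - g w)).
Proof. by move=> hf hg; exact: (integrableB measurableT hf hg). Qed.

Lemma integrable_sumR n (f : 'I_n -> T -> R) :
  (forall i, P.-integrable setT (EFin \o f i)) ->
  P.-integrable setT (EFin \o (fun w => \sum_(i < n) f i w)).
Proof.
move=> hf; rewrite (_ : _ \o _ = fun w => (\sum_(i < n) (EFin \o f i) w)%E).
  exact: integrable_sum.
by apply/funext => w; rewrite /= sumEFin.
Qed.

Lemma integrable_boundedR (c : R) (f : T -> R) : measurable_fun setT f ->
  (forall w, `|f w| <= c) -> P.-integrable setT (EFin \o f).
Proof.
move=> mf fc; apply: (le_integrable _ _ _ (integrable_cstR c)) => //.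
  exact/measurable_EFinP.
by move=> w _ /=; rewrite lee_fin (le_trans (fc w))// ler_norm.
Qed.

Lemma Rintegral_sum n (f : 'I_n -> T -> R) :
  (forall i, P.-integrable setT (EFin \o f i)) ->
  \int[P]_w (\sum_(i < n) f i w) = \sum_(i < n) \int[P]_w f i w.
Proof.
elim: n f => [|n IH] f hf.
  rewrite big_ord0; under eq_Rintegral do rewrite big_ord0.
  by rewrite Rintegral_cst// mul0r.
rewrite big_ord_recr/= -IH//; under eq_Rintegral do rewrite big_ord_recr/=.
by rewrite RintegralD//; exact: integrable_sumR.
Qed.

Lemma Rintegral_cst_prob (c : R) : \int[P]_w c = c.
Proof. by rewrite Rintegral_cst//; have /= -> := probability_setT P; rewrite mulr1. Qed.

(** Integrate the pointwise bound 1 - (delta / a) f <= 1_A: on A it holds since f is nonnegative,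
    off A since f > a / delta makes the left side negative. *)
Lemma markov_event (f : T -> R) (A : set T) (a delta : R) :
  measurable A -> P.-integrable setT (EFin \o f) -> (forall w, 0 <= f w) ->
  0 < a -> 0 < delta -> \int[P]_w f w <= a ->
  (forall w, f w <= a / delta -> A w) -> ((1 - delta)%:E <= P A)%E.
Proof.
move=> mA fi f0 a0 d0 fa fA.
have iA : P.-integrable setT (EFin \o (\1_A : T -> R)) by exact: integrable_indic.
have -> : P A = (\int[P]_w \1_A w)%:E.
  rewrite /Rintegral integral_indic// setIT fineK//.
  exact: fin_num_measure.
rewrite lee_fin; apply: (@le_trans _ _ (\int[P]_w (1 - delta / a * f w))).
  rewrite RintegralB//; [|exact: integrable_cstR|exact: integrableZR].
  rewrite Rintegral_cst_prob RintegralZl// lerD2l lerN2.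
  rewrite -[leRHS](mulfVK (lt0r_neq0 a0)) ler_pM2l// divr_gt0//.
apply: le_Rintegral => //.
  by apply: integrableBR; [exact: integrable_cstR|exact: integrableZR].
move=> w _; rewrite indicE; have [h|h] := boolP (w \in A).
  by rewrite lerBlDr lerDl mulr_ge0// divr_ge0// ltW.
have : a / delta < f w.
  by rewrite ltNge; apply/negP => /fA ?; move/negP: h; apply; rewrite inE.
rewrite ltr_pdivrMr// => h1; rewrite subr_le0 mulrAC ler_pdivlMr// mul1r mulrC ltW//.
Qed.

End real_valued_integrals.

Section conditional_expectation.
Context {disp : measure_display} {T : measurableType disp} {R : realType}.
Variables (P : probability T R) (S : set (set T)).
Hypotheses (ST : S setT) (Sm : S `<=` measurable).

Lemma measurable_wrt_fun {disp'} {E : measurableType disp'} (f : T -> E) :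
  measurable_wrt S f -> measurable_fun setT f.
Proof. by move=> mf _ B mB; rewrite setTI; apply: Sm; exact: mf. Qed.

(** The residual X - Y integrates to zero over each set of S, hence against any bounded weight known
    to S. *)
Lemma cond_exp_orthogonal (X Y Z : T -> R) : is_cond_exp P S X Y ->
  measurable_wrt S Z -> (forall w, `|Z w| <= 1) ->
  \int[P]_w (Z w * (X w - Y w)) = 0.
Proof.
move=> [iX iY _ XY] mZ Z1; apply: (Rintegral_orthogonal ST Sm) => //.
- exact: measurable_wrt_fun.
- move=> t; rewrite (_ : mkset _ = Z @^-1` `[t, +oo[); first exact: mZ.
  by apply/seteqP; split => w; rewrite /= in_itv/= andbT.
- exact: integrableBR.
move=> A SA; have mA : measurable A by exact: Sm.
rewrite RintegralB//; [|exact: integrableS iX|exact: integrableS iY].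
by rewrite /Rintegral XY// subrr.
Qed.

(** Orthogonality replaces X by its conditional version Y under the weight Z, and then the almost
    sure bound on Y applies. *)
Lemma cond_exp_le_weighted (X Z : T -> R) (c : R) : cond_exp_le P S X c ->
  measurable_wrt S Z -> (forall w, 0 <= Z w <= 1) ->
  \int[P]_w (Z w * X w) <= c * \int[P]_w Z w.
Proof.
move=> [Y XY Yc] mZ Z01; have [iX iY _ _] := XY.
have mZ' := measurable_wrt_fun mZ.
have Z1 w : `|Z w| <= 1 by have /andP[z0 z1] := Z01 w; rewrite ger0_norm.
have iZ : P.-integrable setT (EFin \o Z) by exact: integrable_boundedR Z1.
have iZX := integrable_bounded_mul mZ' Z1 iX.
have iZY := integrable_bounded_mul mZ' Z1 iY.
have := cond_exp_orthogonal XY mZ Z1.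
under eq_Rintegral do rewrite mulrBr.
rewrite RintegralB// => /eqP; rewrite subr_eq0 => /eqP ->.
rewrite -subr_ge0 -RintegralZl// -RintegralB//; last exact: integrableZR.
have iW : P.-integrable setT (EFin \o (fun w => c * Z w - Z w * Y w)).
  by apply: integrableBR => //; exact: integrableZR.
(* The integrand is nonnegative only almost everywhere; it is exchanged for its absolute value,
   which is nonnegative everywhere. *)
have -> : \int[P]_w (c * Z w - Z w * Y w) = \int[P]_w `|c * Z w - Z w * Y w|.
  congr fine; apply: ae_eq_integral => //.
  - exact: measurable_int iW.
  - apply/measurable_EFinP; apply: measurableT_comp => //.
    by apply/measurable_EFinP; exact: measurable_int iW.
  apply: filterS Yc => w Yc _; congr EFin.
  rewrite ger0_norm// mulrC -mulrBr mulr_ge0// ?subr_ge0//.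
  by have /andP[] := Z01 w.
by apply: Rintegral_ge0.
Qed.

End conditional_expectation.

(** * Scalar estimates *)

Section scalar_estimates.
Context {R : realType}.
Implicit Types b c eps sigma : R.

(** After multiplication by b' + S the left side becomes |n^2 - g^2 - sigma^2|, and n <= b', g <= S,
    sigma <= S bound both pieces by multiples of b' + S. *)
Lemma sqrt_add_dist (n g D sigma b b' S : R) :
  0 <= n -> 0 <= g -> 0 <= D -> 0 <= sigma -> 0 < b' -> 0 < S ->
  b' ^+ 2 = b ^+ 2 + n ^+ 2 -> S ^+ 2 = b ^+ 2 + g ^+ 2 + sigma ^+ 2 ->
  `|n ^+ 2 - g ^+ 2| <= D * (n + g) ->
  `|b' - S| <= D + sigma.
Proof.
move=> n0 g0 D0 s0 b'0 S0 b'E SE nD.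
have b2 := sqr_ge0 b; have n2 := sqr_ge0 n.
have g2 := sqr_ge0 g; have s2 := sqr_ge0 sigma.
have nb : n <= b' by rewrite -ler_sqr ?nnegrE ?(ltW b'0)// b'E lerDr.
have gS : g <= S by rewrite -ler_sqr ?nnegrE ?(ltW S0)// SE; lra.
have sS : sigma <= S by rewrite -ler_sqr ?nnegrE ?(ltW S0)// SE; lra.
have bS : 0 < b' + S by rewrite addr_gt0.
rewrite -(ler_pM2r bS) -{1}(gtr0_norm bS) -normrM -subr_sqr b'E SE.
rewrite (_ : _ - _ = n ^+ 2 - g ^+ 2 - sigma ^+ 2); last ring.
apply: (le_trans (ler_normB _ _)); rewrite (ger0_norm s2).
have h1 : D * (n + g) <= D * (b' + S) by rewrite ler_wpM2l// lerD.
have h2 : sigma ^+ 2 <= sigma * (b' + S) by rewrite expr2 ler_wpM2l//; lra.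
lra.
Qed.

(* [eps] stands for [sigma], by which one could not divide when [sigma = 0]. *)
Lemma surrogate_step (n g D sigma eps b b' S c : R) :
  0 <= n -> 0 <= g -> 0 <= D -> 0 <= sigma -> 0 < eps -> 0 < b' -> 0 < S ->
  b' ^+ 2 = b ^+ 2 + n ^+ 2 -> S ^+ 2 = b ^+ 2 + g ^+ 2 + sigma ^+ 2 ->
  `|n ^+ 2 - g ^+ 2| <= D * (n + g) -> `|c| <= g * n ->
  c / S - (D ^+ 2 * (g / S) ^+ 2 / (4 * eps) + sigma * (g / S) ^+ 2 / 4)
  <= c / b' + (eps + sigma) * (n / b') ^+ 2.
Proof.
move=> n0 g0 D0 s0 e0 b'0 S0 b'E SE nD cgn.
have dS := sqrt_add_dist n0 g0 D0 s0 b'0 S0 b'E SE nD.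
set u := n / b'; set v := g / S.
have u0 : 0 <= u by rewrite divr_ge0// ltW.
have v0 : 0 <= v by rewrite divr_ge0// ltW.
(* Exchanging the denominators costs c (b' - S) / (S b'), where |c| <= g n and |b' - S| <= D +
   sigma. *)
have h : c / S - c / b' <= (D + sigma) * (u * v).
  rewrite (_ : c / S - c / b' = (c * (b' - S)) / (S * b')); last first.
    by field; rewrite !gt_eqF.
  rewrite (_ : (D + sigma) * (u * v) = (g * n) * (D + sigma) / (S * b')); last first.
    by rewrite /u /v; field; rewrite !gt_eqF.
  rewrite ler_pM2r ?invr_gt0 ?mulr_gt0//.
  by apply: (le_trans (ler_norm _)); rewrite normrM ler_pM.
(* Young's inequality, proved by completing the square: weight [eps] for the D part, weight [sigma]
   for the sigma part in [h2]. *)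
have h1 : D * (u * v) <= eps * u ^+ 2 + D ^+ 2 * v ^+ 2 / (4 * eps).
  rewrite -subr_ge0.
  rewrite (_ : _ - _ = eps * (u - D * v / (2 * eps)) ^+ 2); last first.
    by field; rewrite gt_eqF.
  by rewrite mulr_ge0 ?sqr_ge0// ltW.
have h2 : sigma * (u * v) <= sigma * u ^+ 2 + sigma * v ^+ 2 / 4.
  rewrite -subr_ge0 (_ : _ - _ = sigma * (u - v / 2) ^+ 2); last by field.
  by rewrite mulr_ge0 ?sqr_ge0.
lra.
Qed.

(** Concavity of ln: this is ln (1 + t) <= t at t = y / m - 1, rescaled by m. *)
Lemma ln_le_tangent (m y : R) : 0 < m -> 0 < y -> ln y <= ln m + y / m - 1.
Proof.
move=> m0 y0; have ym : 0 < y / m by rewrite divr_gt0.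
rewrite [X in ln X](_ : y = m * (y / m)); last by field; rewrite gt_eqF.
rewrite lnM ?posrE// -addrA lerD2l.
have := @le_ln1Dx R (y / m - 1); rewrite (_ : 1 + _ = y / m); last by ring.
by apply; lra.
Qed.

(** The left side equals 1 - b^2 / b'^2, which the tangent of ln at b'^2 bounds by an increment that
    telescopes along the iteration. *)
Lemma sqr_ratio_le_ln (n b b' : R) : 0 < b -> 0 < b' ->
  b' ^+ 2 = b ^+ 2 + n ^+ 2 -> (n / b') ^+ 2 <= ln (b' ^+ 2) - ln (b ^+ 2).
Proof.
move=> b0 b'0 b'E.
have := @ln_le_tangent (b' ^+ 2) (b ^+ 2).
rewrite !exprn_gt0// => /(_ erefl erefl).
rewrite (_ : (n / b') ^+ 2 = 1 - b ^+ 2 / b' ^+ 2); last first.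
  rewrite expr_div_n -[X in X - _](@divff _ (b' ^+ 2)) ?gt_eqF ?exprn_gt0//.
  by rewrite -mulrBl b'E; congr (_ / _); ring.
lra.
Qed.

Lemma powR_three_halves (delta : R) : 0 < delta ->
  delta `^ (3 / 2) = delta * Num.sqrt delta.
Proof.
move=> d0; rewrite (_ : 3 / 2 = 1 + 2^-1 :> R); last by field.
by rewrite powRD ?gt_eqF ?implybT// powRr1 ?powR12_sqrt ?ltW.
Qed.

(** With U = X / Q and p = V / B, the squared bound on Y is 4 Q^2 B U^2 p. AM-GM under 2 U + p <= 3
    / delta gives U^2 p <= delta^-3, the source of the power 3/2, and B is at most (b0 + 2 sqrt n
    tau)^2. *)
Lemma first_rate (Y X V Q n b0 tau delta : R) :
  0 < Q -> 0 < n -> 0 < b0 -> 0 <= tau -> 0 < delta -> 0 <= X -> 0 <= V ->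
  0 <= Y -> Y <= 2 * X * Num.sqrt V ->
  2 * (X / Q) + V / (b0 ^+ 2 + 4 * n * tau ^+ 2) <= 3 / delta ->
  Y / n <= (2 * b0 / n + 4 * tau / Num.sqrt n) * (Q / delta `^ (3 / 2)).
Proof.
move=> Q0 n0 b00 t0 d0 X0 V0 Y0 YX.
set B := b0 ^+ 2 + _; set U := X / Q; set p := V / B => Up.
have B0 : 0 < B by rewrite ltr_wpDr ?exprn_gt0// mulr_ge0 ?sqr_ge0// mulr_ge0// ltW.
have U0 : 0 <= U by rewrite divr_ge0// ltW.
have p0 : 0 <= p by rewrite divr_ge0// ltW.
have amgm : U ^+ 2 * p <= (delta ^+ 3)^-1.
  (* AM-GM for U, U, p *)
  have h : 27 * (U ^+ 2 * p) <= (2 * U + p) ^+ 3.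
    rewrite -subr_ge0 (_ : _ - _ = (U - p) ^+ 2 * (8 * U + p)); last by ring.
    by rewrite mulr_ge0 ?sqr_ge0// addr_ge0// mulr_ge0.
  have h1 : (2 * U + p) ^+ 3 <= (3 / delta) ^+ 3.
    have d3 : 0 <= 3 / delta by rewrite ltW// divr_gt0.
    have Up0 : 0 <= 2 * U + p by rewrite addr_ge0// mulr_ge0.
    by rewrite ler_pXn2r.
  rewrite -(@ler_pM2l _ 27)//; apply: (le_trans h); apply: (le_trans h1).
  by rewrite (_ : (3 / delta) ^+ 3 = 27 / delta ^+ 3)//; field; rewrite gt_eqF.
rewrite powR_three_halves//; set sd := Num.sqrt delta; set sn := Num.sqrt n.
have sd0 : 0 < sd by rewrite sqrtr_gt0.
have sn0 : 0 < sn by rewrite sqrtr_gt0.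
have sdE : sd ^+ 2 = delta by rewrite sqr_sqrtr// ltW.
have snE : sn ^+ 2 = n by rewrite sqr_sqrtr// ltW.
pose beta := b0 + 2 * sn * tau.
have beta0 : 0 < beta by rewrite ltr_wpDr// mulr_ge0// mulr_ge0// ltW.
have Bbeta : B <= beta ^+ 2.
  rewrite -subr_ge0 /B /beta -snE (_ : _ - _ = 4 * b0 * sn * tau); last by ring.
  by rewrite mulr_ge0// mulr_ge0 ?(ltW sn0)// mulr_ge0// ltW.
have key : Y <= 2 * Q * beta / (delta * sd).
  have r0 : 0 <= 2 * Q * beta / (delta * sd).
    by rewrite ltW// divr_gt0 ?mulr_gt0.
  rewrite -ler_sqr ?nnegrE//.
  apply: (@le_trans _ _ ((2 * X * Num.sqrt V) ^+ 2)).
    by rewrite ler_sqr ?nnegrE// mulr_ge0 ?sqrtr_ge0// mulr_ge0.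
  rewrite exprMn sqr_sqrtr//.
  rewrite (_ : _ * V = 4 * Q ^+ 2 * B * (U ^+ 2 * p)); last first.
    by rewrite /U /p; field; rewrite !gt_eqF.
  rewrite (_ : (2 * Q * beta / (delta * sd)) ^+ 2 =
    4 * Q ^+ 2 * beta ^+ 2 * (delta ^+ 3)^-1); last first.
    by rewrite -sdE; field; rewrite gt_eqF.
  have Q2 : 0 <= 4 * Q ^+ 2 by rewrite mulr_ge0 ?sqr_ge0.
  have UB : 0 <= 4 * Q ^+ 2 * B by rewrite mulr_ge0// ltW.
  have BB : 4 * Q ^+ 2 * B <= 4 * Q ^+ 2 * beta ^+ 2 by exact: ler_wpM2l.
  by apply: ler_pM => //; rewrite mulr_ge0 ?sqr_ge0.
rewrite ler_pdivrMr//; apply: (le_trans key).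
by rewrite /beta -snE le_eqVlt; apply/orP; left; apply/eqP; field; rewrite !gt_eqF.
Qed.

(* The term [delta * b0 ^+ 2] keeps the normalization of [W] positive when
   [sigma = 0]; the slack in the [2 * b0] of the conclusion pays for it. *)
Lemma second_rate (Y X W Q n b0 sigma delta : R) :
  0 < Q -> 0 < n -> 0 < b0 -> 0 <= sigma -> 0 < delta < 1 -> 0 <= X ->
  0 <= W -> 0 <= Y -> Y <= 2 * X * Num.sqrt (b0 ^+ 2 + 2 * Y + W) ->
  X / Q + (W + delta * b0 ^+ 2) / (2 * n * sigma ^+ 2 + delta * b0 ^+ 2)
    <= 2 / delta ->
  Y / n <= (8 * Q / delta + 2 * b0) * (4 * Q / (n * delta))
           + 8 * Q * sigma / (delta `^ (3 / 2) * Num.sqrt n).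
Proof.
move=> Q0 n0 b00 s0 /andP[d0 d1] X0 W0 Y0 YX.
have b2 : 0 < b0 ^+ 2 by rewrite exprn_gt0.
have db : 0 < delta * b0 ^+ 2 by rewrite mulr_gt0.
have ns : 0 <= 2 * n * sigma ^+ 2 by rewrite mulr_ge0 ?sqr_ge0// mulr_ge0// ltW.
set C := 2 * n * _ + _ => XW.
have C0 : 0 < C by rewrite ltr_wpDl.
(* Both terms of the combination are nonnegative, so each alone is at most 2 / delta; [WC] uses the
   other one. *)
have XH : X <= 2 * Q / delta.
  have : X / Q <= 2 / delta.
    by apply: le_trans XW; rewrite lerDl divr_ge0 ?addr_ge0// ltW.
  by rewrite ler_pdivrMr// mulrAC.
have WC : W <= 4 * n * sigma ^+ 2 / delta + 2 * b0 ^+ 2.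
  have : (W + delta * b0 ^+ 2) / C <= 2 / delta.
    by apply: le_trans XW; rewrite lerDr divr_ge0// ltW.
  rewrite ler_pdivrMr//; rewrite (_ : 2 / delta * C =
    4 * n * sigma ^+ 2 / delta + 2 * b0 ^+ 2); last by rewrite /C; field; rewrite gt_eqF.
  by move=> h; apply: le_trans h; rewrite lerDl ltW.
rewrite powR_three_halves//; set sd := Num.sqrt delta; set sn := Num.sqrt n.
have sd0 : 0 < sd by rewrite sqrtr_gt0.
have sn0 : 0 < sn by rewrite sqrtr_gt0.
have sdE : sd ^+ 2 = delta by rewrite sqr_sqrtr// ltW.
have snE : sn ^+ 2 = n by rewrite sqr_sqrtr// ltW.
(* [k] is an upper bound for the square root of b0^2 + W, by [WC] and by a^2 + c^2 <= (a + c)^2 for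
   nonnegative a and c. *)
pose k := 2 * b0 + 2 * sigma * sn / sd.
have sk : 0 <= 2 * sigma * sn / sd by rewrite divr_ge0 ?mulr_ge0// ltW.
have k0 : 0 <= k by rewrite addr_ge0// mulr_ge0// ltW.
have Kk : b0 ^+ 2 + W <= k ^+ 2.
  apply: (@le_trans _ _ (4 * b0 ^+ 2 + (2 * sigma * sn / sd) ^+ 2)).
    rewrite (_ : (2 * sigma * sn / sd) ^+ 2 = 4 * n * sigma ^+ 2 / delta); last first.
      by rewrite -snE -sdE; field; rewrite gt_eqF.
    lra.
  rewrite /k -subr_ge0.
  rewrite (_ : _ - _ = 4 * b0 * (2 * sigma * sn / sd)); last by field; rewrite gt_eqF.
  by rewrite mulr_ge0// mulr_ge0// ltW.
set H := 2 * Q / delta in XH.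
have H0 : 0 < H by rewrite divr_gt0// mulr_gt0.
have Y2 : Y ^+ 2 <= 4 * H ^+ 2 * (2 * Y + k ^+ 2).
  apply: (@le_trans _ _ ((2 * X * Num.sqrt (b0 ^+ 2 + 2 * Y + W)) ^+ 2)).
    by rewrite ler_sqr ?nnegrE// mulr_ge0 ?sqrtr_ge0// mulr_ge0.
  have V0 : 0 <= b0 ^+ 2 + 2 * Y + W by lra.
  have XH2 : (2 * X) ^+ 2 <= 4 * H ^+ 2.
    rewrite exprMn (_ : 2 ^+ 2 = 4); last by ring.
    by rewrite ler_pM2l// ler_sqr ?nnegrE// ltW.
  rewrite exprMn sqr_sqrtr//; apply: ler_pM => //; first exact: sqr_ge0.
  lra.
(* [Y2] is quadratic in Y, of the form Y (Y - 8 H^2) <= (2 H k)^2, and a Y above the asserted bound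
   would violate it. *)
have key : Y <= 8 * H ^+ 2 + 2 * H * k.
  rewrite leNgt; apply/negP => h.
  have Hk : 0 <= 2 * H * k by rewrite mulr_ge0// mulr_ge0// ltW.
  have H2 : 0 <= 8 * H ^+ 2 by rewrite mulr_ge0 ?sqr_ge0.
  have : (8 * H ^+ 2 + 2 * H * k) * (2 * H * k) < Y * (Y - 8 * H ^+ 2).
    by apply: ltr_pM => //; [rewrite addr_ge0|lra].
  have : 0 <= 8 * H ^+ 2 * (2 * H * k) by rewrite mulr_ge0.
  lra.
rewrite ler_pdivrMr//; apply: (le_trans key).
rewrite /H /k -snE -sdE le_eqVlt; apply/orP; left; apply/eqP; field.
by rewrite !gt_eqF.
Qed.

End scalar_estimates.

(** * AdaGrad-Norm *)

Lemma sum_ord_widen_le {R : realType} (f : nat -> R) (k N : nat) :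
  (forall j, 0 <= f j) -> (k <= N)%N -> \sum_(j < k) f j <= \sum_(j < N) f j.
Proof.
move=> f0 kN; rewrite -(subnKC kN) big_split_ord/= lerDl.
by apply: sumr_ge0 => j _.
Qed.

Lemma measurable_fun_bigmin {disp : measure_display} {T : measurableType disp}
    {R : realType} (f0 : T -> R) (f : nat -> T -> R) (N : nat) :
  measurable_fun setT f0 -> (forall k, measurable_fun setT (f k)) ->
  measurable_fun setT (fun w => \big[Num.min/f0 w]_(k < N) f k w).
Proof.
move=> mf0; elim: N f => [|N IH] f mf.
  by under eq_fun do rewrite big_ord0.
under eq_fun do rewrite big_ord_recl.
by apply: measurable_minr => //; apply: (IH (fun k => f k.+1)) => k.
Qed.

Section adagrad_bounds.
Context {R : realType} {d m : nat}.
Context {disp : measure_display} {T : measurableType disp}.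
Variable P : probability T R.
Variables (F : 'rV[R]_d -> R) (L : R).
Variable G : 'rV[R]_d -> 'rV[R]_m -> 'rV[R]_d.
Variable xi : nat -> T -> 'rV[R]_m.
Variables (x0 : 'rV[R]_d) (b0 eta : R).
Variables (x : nat -> T -> 'rV[R]_d) (b : nat -> T -> R).
Variables sigma gamma : R.
Hypotheses (hF : C1L L F) (hFinf : has_lbound (range F)).
Hypothesis mG : measurable_fun setT (fun z : 'rV[R]_d * 'rV[R]_m => G z.1 z.2).
Hypothesis mxi : forall k, measurable_fun setT (xi k).
Hypotheses (hb0 : 0 < b0) (heta : 0 < eta).
Hypothesis hxb : adagrad_norm G eta x0 b0 xi x b.
Hypotheses (hsigma : 0 <= sigma) (hgamma : 0 <= gamma).
Hypothesis hunbiased : forall k, is_cond_exp_rV P (past xi k)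
  (fun w => G (x k w) (xi k w)) (fun w => gradient F (x k w)).
Hypothesis hvar : forall k, cond_exp_le P (past xi k)
  (fun w => l2norm (G (x k w) (xi k w) - gradient F (x k w)) ^+ 2) (sigma ^+ 2).
Hypothesis hgrad : forall y, l2norm (gradient F y) ^+ 2 <= gamma ^+ 2.

(** * Pathwise quantities and estimates *)

Let g k w : R := l2norm (gradient F (x k w)).
Let n k w : R := l2norm (G (x k w) (xi k w)).
Let D k w : R := l2norm (G (x k w) (xi k w) - gradient F (x k w)).
Let S k w : R := Num.sqrt (b k w ^+ 2 + g k w ^+ 2 + sigma ^+ 2).
Let c k w : R := dotp (gradient F (x k w)) (G (x k w) (xi k w)).
Let v k w : R := g k w / S k w.
(** The descent term with denominator [S k], less the error that [surrogate_step] charges for the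
    exchange. *)
Let h (eps : R) k w : R :=
  c k w / S k w - (D k w ^+ 2 * v k w ^+ 2 / (4 * eps) + sigma * v k w ^+ 2 / 4).
Let X k w : R := g k w ^+ 2 / (2 * S k w).

Let g_ge0 k w : 0 <= g k w. Proof. exact: l2norm_ge0. Qed.
Let n_ge0 k w : 0 <= n k w. Proof. exact: l2norm_ge0. Qed.
Let D_ge0 k w : 0 <= D k w. Proof. exact: l2norm_ge0. Qed.

Let g_le k w : g k w <= gamma.
Proof. by rewrite -ler_sqr ?nnegrE// hgrad. Qed.

Let b_gt0 k w : 0 < b k w.
Proof. by have [_ b0E bpos _ _] := hxb w; case: k => [|k]; rewrite ?b0E. Qed.

Let S_sqr k w : S k w ^+ 2 = b k w ^+ 2 + g k w ^+ 2 + sigma ^+ 2.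
Proof. by rewrite sqr_sqrtr// !addr_ge0 ?sqr_ge0. Qed.

Let S_gt0 k w : 0 < S k w.
Proof.
rewrite sqrtr_gt0 -addrA ltr_wpDr ?addr_ge0 ?sqr_ge0//.
by rewrite exprn_gt0.
Qed.

Let g_le_S k w : g k w <= S k w.
Proof.
rewrite -ler_sqr ?nnegrE ?(ltW (S_gt0 k w))// S_sqr.
by have := sqr_ge0 (b k w); have := sqr_ge0 sigma; lra.
Qed.

Let sigma_le_S k w : sigma <= S k w.
Proof.
rewrite -ler_sqr ?nnegrE ?(ltW (S_gt0 k w))// S_sqr.
by have := sqr_ge0 (b k w); have := sqr_ge0 (g k w); lra.
Qed.

Let v01 k w : 0 <= v k w <= 1.
Proof. by rewrite divr_ge0 ?(ltW (S_gt0 k w))//= ler_pdivrMr// mul1r. Qed.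

Let X_ge0 k w : 0 <= X k w.
Proof. by rewrite divr_ge0 ?sqr_ge0// mulr_ge0// ltW. Qed.

(** The descent inequality divided by [eta] bounds [c k w / b k.+1 w]; [surrogate_step] brings in
    [h], and the squared ratios turn into log increments. *)
Let one_step eps k w : 0 < eps ->
  h eps k w <= (F (x k w) - F (x k.+1 w)) / eta
    + (eps + sigma + eta * L / 2) * (ln (b k.+1 w ^+ 2) - ln (b k w ^+ 2)).
Proof.
move=> e0; have [dF L0 FL _] := hF; have [_ _ _ bE xE] := hxb w.
have hs := @surrogate_step R (n k w) (g k w) (D k w) sigma eps (b k w)
  (b k.+1 w) (S k w) (c k w) (n_ge0 k w) (g_ge0 k w) (D_ge0 k w) hsigma e0
  (b_gt0 k.+1 w) (S_gt0 k w) (bE k) (S_sqr k w) (l2norm_sqr_dist _ _)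
  (normr_dotp_le _ _).
apply: (le_trans hs).
have hln : (n k w / b k.+1 w) ^+ 2 <= _ :=
  sqr_ratio_le_ln (b_gt0 k w) (b_gt0 k.+1 w) (bE k).
have := grad_lipschitz_descent (L := L) dF (x k w)
  (- (eta / b k.+1 w) *: G (x k w) (xi k w)) FL.
rewrite scaleNr -xE -scaleNr dotpZr l2normZ normrN exprMn real_normK ?num_real//.
rewrite -/(c k w) -/(n k w) => hd.
have hc : c k w / b k.+1 w <= (F (x k w) - F (x k.+1 w)) / eta
    + eta * L / 2 * (n k w / b k.+1 w) ^+ 2.
  rewrite -(ler_pM2l heta) mulrDr.
  rewrite [eta * (_ / eta)]mulrC divfK ?gt_eqF//.
  move: hd; rewrite (_ : eta * (c k w / _) = eta / b k.+1 w * c k w); last by ring.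
  rewrite (_ : L / 2 * _ = eta * (eta * L / 2 * (n k w / b k.+1 w) ^+ 2)); last by ring.
  lra.
have K0 : 0 <= eps + sigma + eta * L / 2.
  by rewrite !addr_ge0 ?divr_ge0 ?mulr_ge0// ltW.
have := ler_wpM2l K0 hln; lra.
Qed.

(** Both differences telescope; the last value of F is then replaced by the infimum. *)
Let sum_step eps N w : 0 < eps ->
  \sum_(k < N) h eps k w <= (F x0 - inf (range F)) / eta
    + (eps + sigma + eta * L / 2) * (ln (b N w ^+ 2) - ln (b0 ^+ 2)).
Proof.
move=> e0.
have Finf : inf (range F) <= F (x N w) by apply: ge_inf => //; exists (x N w).
have : \sum_(k < N) h eps k w <= (F x0 - F (x N w)) / eta
    + (eps + sigma + eta * L / 2) * (ln (b N w ^+ 2) - ln (b0 ^+ 2)).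
  elim: N {Finf} => [|N IH].
    have [-> -> _ _ _] := hxb w.
    by rewrite big_ord0 !subrr mul0r mulr0 addr0.
  by rewrite big_ord_recr/=; have := one_step N w e0; lra.
move/le_trans; apply; rewrite lerD2r ler_pM2r ?invr_gt0//.
by rewrite lerD2l lerN2.
Qed.

Let b_sqr_le k w : b k w ^+ 2 <=
  b0 ^+ 2 + 2 * \sum_(j < k) g j w ^+ 2 + 2 * \sum_(j < k) D j w ^+ 2.
Proof.
elim: k => [|k IH].
  by have [_ -> _ _ _] := hxb w; rewrite !big_ord0 !mulr0 !addr0.
have [_ _ _ -> _] := hxb w; rewrite !big_ord_recr/=.
have := l2norm_sqr_le2 (G (x k w) (xi k w)) (gradient F (x k w)).
by rewrite -/(D k w) -/(g k w); lra.
Qed.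

Let sum_g_le k w : \sum_(j < k) g j w ^+ 2 <= k%:R * gamma ^+ 2.
Proof.
apply: (@le_trans _ _ (\sum_(j < k) gamma ^+ 2)).
  by apply: ler_sum => j _; exact: hgrad.
by rewrite sumr_const card_ord mulr_natl.
Qed.

(** * Measurability, integrability and means of the one-step quantities *)

Let ST k : past xi k setT.
Proof. exact: (@measurableT _ (g_sigma_algebraType _)). Qed.

Let Sm k : past xi k `<=` measurable.
Proof. exact: past_sub_measurable. Qed.

Let past_grad k i : measurable_wrt (past xi k) (fun w => gradient F (x k w) ord0 i).
Proof. by case: (hunbiased k i). Qed.

Let past_invS k : measurable_wrt (past xi k) (fun w => (S k w)^-1).
Proof.
apply/measurable_wrtP; apply: measurable_fun_inv_gt0 => //.
apply: measurable_fun_sqrt; apply: measurable_funD => //.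
apply: measurable_funD.
  apply: measurable_funX; apply/measurable_wrtP.
  by case: (adagrad_measurable mG hxb k).
apply/measurable_wrtP; apply: measurable_wrt_l2norm_sqr => i.
exact: past_grad.
Qed.

Let past_v2 k : measurable_wrt (past xi k) (fun w => v k w ^+ 2).
Proof.
rewrite (_ : (fun w => _) = fun w => g k w ^+ 2 * (S k w)^-1 ^+ 2); last first.
  by apply/funext => w; rewrite -exprMn.
apply/measurable_wrtP.
apply: measurable_funM.
  apply/measurable_wrtP; apply: measurable_wrt_l2norm_sqr => i.
  exact: past_grad.
by apply: measurable_funX; apply/measurable_wrtP; exact: past_invS.
Qed.

Let past_dir k i :
  measurable_wrt (past xi k) (fun w => gradient F (x k w) ord0 i / S k w).
Proof.
apply/measurable_wrtP; apply: measurable_funM; apply/measurable_wrtP.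
  exact: past_grad.
exact: past_invS.
Qed.

Let dir_le1 k i w : `|gradient F (x k w) ord0 i / S k w| <= 1.
Proof.
rewrite normrM [`|_^-1|]gtr0_norm ?invr_gt0// ler_pdivrMr// mul1r.
exact: le_trans (coord_le_l2norm _ _) (g_le_S k w).
Qed.

Let v2_01 k w : 0 <= v k w ^+ 2 <= 1.
Proof. by have /andP[v0 v1] := v01 k w; rewrite sqr_ge0 exprn_ile1. Qed.

Let v2_norm k w : `|v k w ^+ 2| <= 1.
Proof. by have /andP[v0 v1] := v2_01 k w; rewrite ger0_norm. Qed.

Let iD k : P.-integrable setT (EFin \o (fun w => D k w ^+ 2)).
Proof. by have [Y [iX _ _ _] _] := hvar k. Qed.

Let mean_D k : \int[P]_w (D k w ^+ 2) <= sigma ^+ 2.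
Proof.
have m1 : measurable_wrt (past xi k) (fun=> 1 : R).
  by apply/measurable_wrtP; exact: measurable_cst.
have := cond_exp_le_weighted (@ST k) (@Sm k) (hvar k) m1.
rewrite Rintegral_cst_prob mulr1; under eq_Rintegral do rewrite mul1r.
by apply => w; rewrite ler01 lexx.
Qed.

Let iv2 k : P.-integrable setT (EFin \o (fun w => v k w ^+ 2)).
Proof.
apply: integrable_boundedR (v2_norm k).
by have := measurable_wrt_fun (@Sm k) (@past_v2 k).
Qed.

Let iv2D k : P.-integrable setT (EFin \o (fun w => v k w ^+ 2 * D k w ^+ 2)).
Proof.
apply: integrable_bounded_mul (v2_norm k) (iD k).
by have := measurable_wrt_fun (@Sm k) (@past_v2 k).
Qed.

Let mX k : measurable_fun setT (X k).
Proof.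
rewrite (_ : X k = fun w => g k w ^+ 2 * 2^-1 * (S k w)^-1); last first.
  by apply/funext => w; rewrite /X invfM mulrA.
apply: measurable_funM; last by have := measurable_wrt_fun (@Sm k) (@past_invS k).
apply: measurable_funM => //.
apply: (measurable_fun_l2norm_sqr (f := fun w => gradient F (x k w))) => i.
by have := measurable_wrt_fun (@Sm k) (@past_grad k i).
Qed.

Let X_le k w : X k w <= gamma.
Proof.
rewrite ler_pdivrMr ?mulr_gt0//; apply: (@le_trans _ _ (gamma * S k w)).
  by rewrite expr2 ler_pM.
rewrite mulrCA; have : 0 <= gamma * S k w by rewrite mulr_ge0// ltW.
lra.
Qed.

Let iX k : P.-integrable setT (EFin \o X k).
Proof.
apply: (@integrable_boundedR _ _ _ _ gamma) => // w.
by rewrite ger0_norm.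
Qed.

(** The inner product of grad F with G - grad F, over S, kept as a sum over coordinates since
    unbiasedness is a coordinatewise statement. Each coefficient is known to the past and bounded by
    1. *)
Let noise k w : R := \sum_(i < d) (gradient F (x k w) ord0 i / S k w)
  * (G (x k w) (xi k w) ord0 i - gradient F (x k w) ord0 i).

Let inoise_i k i : P.-integrable setT (EFin \o (fun w =>
  (gradient F (x k w) ord0 i / S k w)
  * (G (x k w) (xi k w) ord0 i - gradient F (x k w) ord0 i))).
Proof.
have [i1 i2 _ _] := hunbiased k i.
apply: integrable_bounded_mul (dir_le1 k i) (integrableBR i1 i2).
by have := measurable_wrt_fun (@Sm k) (@past_dir k i).
Qed.

Let inoise k : P.-integrable setT (EFin \o noise k).
Proof. exact: integrable_sumR. Qed.

Let mean_noise k : \int[P]_w noise k w = 0.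
Proof.
rewrite Rintegral_sum// big1// => i _.
by have := cond_exp_orthogonal (@ST k) (@Sm k) (hunbiased k i)
  (@past_dir k i) (dir_le1 k i).
Qed.

Let hE eps k w : 0 < eps ->
  h eps k w = 2 * X k w + noise k w
     - ((4 * eps)^-1 * (v k w ^+ 2 * D k w ^+ 2) + sigma / 4 * v k w ^+ 2).
Proof.
move=> e0; have -> : noise k w = (c k w - g k w ^+ 2) / S k w.
  rewrite /c /g l2norm_sqr -dotpBr mulr_suml; apply: eq_bigr => i _.
  by rewrite !mxE mulrAC.
by rewrite /h /X; field; rewrite !gt_eqF.
Qed.

Let ih eps k : 0 < eps -> P.-integrable setT (EFin \o h eps k).
Proof.
move=> e0; rewrite (_ : h eps k = fun w => 2 * X k w + noise k w
     - ((4 * eps)^-1 * (v k w ^+ 2 * D k w ^+ 2) + sigma / 4 * v k w ^+ 2)).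
  apply: integrableBR.
    by apply: integrableDR => //; exact: integrableZR.
  by apply: integrableDR; exact: integrableZR.
by apply/funext => w; rewrite hE.
Qed.

(** In [hE] the noise has mean zero. Each error term has mean at most (sigma / 4) E v^2, the first
    by the variance bound and sigma <= eps. As sigma <= S gives sigma E v^2 <= 2 E X, the errors use
    up one of the two copies of E X. *)
Let mean_X_le eps k : 0 < eps -> sigma <= eps ->
  \int[P]_w X k w <= \int[P]_w h eps k w.
Proof.
move=> e0 se; under [leRHS]eq_Rintegral do rewrite hE//.
rewrite RintegralB//; last 2 first.
- by apply: integrableDR => //; exact: integrableZR.
- by apply: integrableDR; exact: integrableZR.
rewrite !RintegralD//; last 3 first.
- exact: integrableZR.
- exact: integrableZR.
- exact: integrableZR.
rewrite !RintegralZl// mean_noise addr0.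
set EX := \int[P]_w X k w; set EvD := \int[P]_w _; set Ev := \int[P]_w _.
have Ev0 : 0 <= Ev by apply: Rintegral_ge0 => w _; rewrite sqr_ge0.
have hvD : EvD <= sigma ^+ 2 * Ev.
  by have := cond_exp_le_weighted (@ST k) (@Sm k) (hvar k) (@past_v2 k) (v2_01 k).
have vX : sigma * Ev <= 2 * EX.
  rewrite -!RintegralZl//; apply: le_Rintegral => //.
  - exact: integrableZR.
  - exact: integrableZR.
  move=> w _; rewrite /X /v.
  rewrite (_ : 2 * (g k w ^+ 2 / _) = (g k w / S k w) ^+ 2 * S k w); last first.
    by field; rewrite gt_eqF.
  by rewrite mulrC ler_wpM2l ?sqr_ge0.
have h1 : (4 * eps)^-1 * EvD <= sigma / 4 * Ev.
  rewrite ler_pdivrMl ?mulr_gt0//; apply: (le_trans hvD).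
  rewrite (_ : 4 * eps * _ = eps * sigma * Ev); last by field.
  by rewrite expr2 ler_wpM2r// ler_wpM2r.
lra.
Qed.

(** * The bound by Q on the mean of the weighted sum *)

Variable N : nat.
Hypothesis hN : (1 <= N)%N.
Let Q := calQ (F x0) (inf (range F)) eta L sigma gamma b0 N.

Let log_arg_ge0 : 0 <= 20 * N%:R * (gamma ^+ 2 + sigma ^+ 2) / b0 ^+ 2.
Proof.
apply: divr_ge0; last exact: sqr_ge0.
by apply: mulr_ge0; rewrite ?mulr_ge0 ?addr_ge0 ?sqr_ge0.
Qed.

Let Q_gt0 : 0 < Q.
Proof.
have [_ L0 _ _] := hF.
have h1 : 0 <= (F x0 - inf (range F)) / eta.
  by rewrite divr_ge0 ?(ltW heta)// subr_ge0; apply: ge_inf => //; exists x0.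
rewrite /Q /calQ ltr_wpDl// mulr_gt0//.
  by rewrite divr_gt0// ltr_wpDl ?mulr_gt0// mulr_ge0.
apply: ln_gt0.
by have := log_arg_ge0; lra.
Qed.

(** The tangent of ln at M, the argument of the logarithm, makes the pathwise bound affine in the
    sum of D^2. On average b_N^2 / b0^2 is at most 1 + 2 N (gamma^2 + sigma^2) / b0^2 <= M, so only
    ln M survives. *)
Let mean_sumX_le_eps eps : 0 < eps -> sigma <= eps ->
  \int[P]_w (\sum_(k < N) X k w) <= (F x0 - inf (range F)) / eta
    + (eps + sigma + eta * L / 2)
      * ln (20 * N%:R * (gamma ^+ 2 + sigma ^+ 2) / b0 ^+ 2 + 10).
Proof.
move=> e0 se; have [_ L0 _ _] := hF.
set M := (X in ln X).
have NN : 0 <= N%:R :> R by [].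
have gs : 0 <= gamma ^+ 2 + sigma ^+ 2 by rewrite addr_ge0 ?sqr_ge0.
have M0 : 0 < M by rewrite ltr_wpDl.
have b2 : 0 < b0 ^+ 2 by rewrite exprn_gt0.
set A := _ / eta; set K := _ + eta * L / 2.
have K0 : 0 <= K by rewrite !addr_ge0 ?divr_ge0 ?mulr_ge0// ltW.
apply: (@le_trans _ _ (\int[P]_w (\sum_(k < N) h eps k w))).
  rewrite !Rintegral_sum//; last by move=> i; exact: ih.
  by apply: ler_sum => i _; exact: mean_X_le.
(* [a + e * s] is the tangent bound when the sum of D^2 equals s. *)
pose a := A + K * (ln M + (b0 ^+ 2 + N%:R * (2 * gamma ^+ 2)) / b0 ^+ 2 / M - 1).
pose e := K * (2 / b0 ^+ 2 / M).
have aE s : a + e * s = A + K * (ln M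
    + ((b0 ^+ 2 + N%:R * (2 * gamma ^+ 2) + 2 * s) / b0 ^+ 2 / M - 1)).
  by rewrite /a /e; ring.
have iSD : P.-integrable setT (EFin \o (fun w => \sum_(k < N) D k w ^+ 2)).
  exact: (integrable_sumR (f := fun (k : 'I_N) w => D k w ^+ 2)).
apply: (@le_trans _ _ (\int[P]_w (a + e * \sum_(k < N) D k w ^+ 2))).
  apply: le_Rintegral => //.
  - by apply: (integrable_sumR (f := fun (k : 'I_N) w => h eps k w)) => k; exact: ih.
  - by apply: integrableDR; [exact: integrable_cstR|exact: integrableZR].
  move=> w _; apply: (le_trans (sum_step N w e0)).
  rewrite aE lerD2l ler_wpM2l//.
  have bN0 : 0 < b N w ^+ 2 by rewrite exprn_gt0.
  rewrite -ln_div ?posrE//.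
  apply: (le_trans (ln_le_tangent M0 (divr_gt0 bN0 b2))).
  have hb : b N w ^+ 2 <= b0 ^+ 2 + N%:R * (2 * gamma ^+ 2)
      + 2 * \sum_(j < N) D j w ^+ 2.
    by have := b_sqr_le N w; have := sum_g_le N w; lra.
  have bM : 0 < (b0 ^+ 2)^-1 * M^-1 by rewrite mulr_gt0 ?invr_gt0.
  have := ler_wpM2r (ltW bM) hb; lra.
rewrite RintegralD//; [|exact: integrable_cstR|exact: integrableZR].
rewrite Rintegral_cst_prob RintegralZl// Rintegral_sum//.
have ED : \sum_(k < N) \int[P]_w (D k w ^+ 2) <= N%:R * sigma ^+ 2.
  apply: (@le_trans _ _ (\sum_(k < N) sigma ^+ 2)); first exact: ler_sum.
  by rewrite sumr_const card_ord mulr_natl.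
have ee : 0 <= e by rewrite mulr_ge0// !divr_ge0// ltW.
apply: (@le_trans _ _ (a + e * (N%:R * sigma ^+ 2))).
  by rewrite lerD2l ler_wpM2l.
rewrite aE lerD2l ler_wpM2l//.
rewrite gerDl subr_le0 ler_pdivrMr// mul1r ler_pdivrMr//.
have -> : M * b0 ^+ 2 = 20 * N%:R * (gamma ^+ 2 + sigma ^+ 2) + 10 * b0 ^+ 2.
  by rewrite /M mulrDl divfK ?gt_eqF.
have : 0 <= N%:R * (gamma ^+ 2 + sigma ^+ 2) by rewrite mulr_ge0.
lra.
Qed.

(** The coefficient 2 sigma + eta L / 2 in Q corresponds to eps = sigma, which may be 0; it is
    reached as the limit of eps = sigma + t with t > 0. *)
Let mean_sumX_le : \int[P]_w (\sum_(k < N) X k w) <= Q.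
Proof.
rewrite /Q /calQ; set A := _ / eta; set l := ln _.
have l0 : 0 <= l.
  apply: ln_ge0.
  by have := log_arg_ge0; lra.
apply/ler_addgt0Pl => e e0.
pose t := e / (l + 1).
have l1 : 0 < l + 1 by rewrite ltr_wpDl.
have t0 : 0 < t by rewrite divr_gt0.
have := @mean_sumX_le_eps (sigma + t); rewrite ltr_wpDl// => /(_ erefl).
rewrite lerDl (ltW t0) => /(_ erefl) /le_trans; apply.
rewrite -/A -/l.
have : t * l <= e.
  by rewrite /t mulrAC ler_pdivrMr// ler_wpM2l ?(ltW e0)// lerDl.
lra.
Qed.

(** * From the weighted sum to the smallest gradient *)

Let SX w : R := \sum_(k < N) X k w.
(** [S k] involves [b k], hence only noise of index below k <= N - 1, so the sum stops one term
    early. This leaves room for the extra sigma^2 within the mean bound 2 N sigma^2. *)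
Let W w : R := 2 * \sum_(k < N.-1) D k w ^+ 2 + sigma ^+ 2.
Let Y w : R := \sum_(k < N) g k w ^+ 2.
(** The default value of the minimum is the term of index 0, itself in the range as N >= 1. *)
Let Z w : R := \big[Num.min/g 0%N w ^+ 2]_(k < N) g k w ^+ 2.

Let SX_ge0 w : 0 <= SX w. Proof. exact: sumr_ge0. Qed.

Let W_ge0 w : 0 <= W w.
Proof. by rewrite addr_ge0 ?sqr_ge0// mulr_ge0// sumr_ge0// => k _; rewrite sqr_ge0. Qed.

Let Y_ge0 w : 0 <= Y w.
Proof. by apply: sumr_ge0 => k _; rewrite sqr_ge0. Qed.

Let S_sqr_le k w : (k < N)%N -> S k w ^+ 2 <= b0 ^+ 2 + 2 * Y w + W w.
Proof.
move=> kN; have kN1 : (k <= N.-1)%N by rewrite -ltnS prednK.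
have hb := b_sqr_le k w.
have hY : \sum_(j < k.+1) g j w ^+ 2 <= Y w.
  by apply: (sum_ord_widen_le (f := fun j => g j w ^+ 2)) => // j; rewrite sqr_ge0.
have hD : \sum_(j < k) D j w ^+ 2 <= \sum_(j < N.-1) D j w ^+ 2.
  by apply: (sum_ord_widen_le (f := fun j => D j w ^+ 2)) => // j; rewrite sqr_ge0.
rewrite big_ord_recr/= in hY; rewrite S_sqr /W.
by have := sqr_ge0 (g k w); lra.
Qed.

(** Termwise, g^2 = 2 S X, and every S with index below N is at most sqrt V. *)
Let Y_le w (V : R) : b0 ^+ 2 + 2 * Y w + W w <= V ->
  Y w <= 2 * SX w * Num.sqrt V.
Proof.
move=> hV; rewrite mulrAC /SX mulr_sumr; apply: ler_sum => k _.
have SV : S k w <= Num.sqrt V.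
  rewrite -[leLHS]ger0_norm ?(ltW (S_gt0 k w))// -sqrtr_sqr.
  by apply: ler_wsqrtr; apply: le_trans hV; exact: S_sqr_le.
rewrite (_ : g k w ^+ 2 = 2 * S k w * X k w); last first.
  by rewrite /X; field; rewrite gt_eqF.
by rewrite ler_wpM2r// ler_wpM2l.
Qed.

(** A minimum is at most the average. *)
Let Z_le w : Z w <= Y w / N%:R.
Proof.
rewrite ler_pdivlMr ?ltr0n// mulrC /Y.
rewrite -[N in N%:R]card_ord -sum1_card natr_sum mulr_suml.
by apply: ler_sum => k _; rewrite mul1r; exact: bigmin_le.
Qed.

Let mZ : measurable_fun setT Z.
Proof.
have mg k : measurable_fun setT (fun w => g k w ^+ 2).
  apply: (measurable_fun_l2norm_sqr (f := fun w => gradient F (x k w))) => i.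
  by have := measurable_wrt_fun (@Sm k) (@past_grad k i).
exact: (measurable_fun_bigmin (f := fun k w => g k w ^+ 2)).
Qed.

Let mZ_le (t : R) : measurable [set w | Z w <= t].
Proof.
have := mZ measurableT (measurable_itv `]-oo, t]%R).
by rewrite setTI (_ : _ @^-1` _ = [set w | Z w <= t]).
Qed.

Let iSX : P.-integrable setT (EFin \o SX).
Proof. exact: integrable_sumR. Qed.

Let iSD k : P.-integrable setT (EFin \o (fun w => \sum_(j < k) D j w ^+ 2)).
Proof. exact: (integrable_sumR (f := fun (j : 'I_k) w => D j w ^+ 2)). Qed.

Let iW : P.-integrable setT (EFin \o W).
Proof.
by apply: integrableDR; [exact: integrableZR|exact: integrable_cstR].
Qed.

Let mean_W : \int[P]_w W w <= 2 * N%:R * sigma ^+ 2.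
Proof.
rewrite RintegralD//; [|exact: integrableZR|exact: integrable_cstR].
rewrite Rintegral_cst_prob RintegralZl// Rintegral_sum//.
have : \sum_(k < N.-1) \int[P]_w (D k w ^+ 2) <= N.-1%:R * sigma ^+ 2.
  apply: (@le_trans _ _ (\sum_(k < N.-1) sigma ^+ 2)); first exact: ler_sum.
  by rewrite sumr_const card_ord mulr_natl.
rewrite -[in X in _ -> _ <= X](prednK hN) -[N.-1.+1]addn1 natrD.
by have := sqr_ge0 sigma; lra.
Qed.

(** * The two rates by Markov's inequality *)

Variable delta : R.
Hypothesis hdelta : 0 < delta < 1.

Let delta_gt0 : 0 < delta. Proof. by case/andP: hdelta. Qed.
Let N_gt0 : 0 < N%:R :> R. Proof. by rewrite ltr0n. Qed.

(** Markov is applied to 2 X / Q + V / B, of mean at most 2 + 1; these weights are the ones AM-GM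
    needs in [first_rate]. B dominates the mean of V, which is at most b0^2 + 2 N (gamma^2 +
    sigma^2). *)
Lemma adagrad_norm_first_rate : ((1 - delta)%:E <= P [set w |
  (\big[Num.min/l2norm (gradient F (x 0%N w)) ^+ 2]_(k < N)
      l2norm (gradient F (x k w)) ^+ 2 <=
    (2 * b0 / N%:R + 4 * (gamma + sigma) / Num.sqrt N%:R)
    * (Q / delta `^ (3 / 2)))%R])%E.
Proof.
set B := b0 ^+ 2 + 4 * N%:R * (gamma + sigma) ^+ 2.
have tau0 : 0 <= gamma + sigma by rewrite addr_ge0.
have B0 : 0 < B.
  by rewrite ltr_wpDr ?exprn_gt0// mulr_ge0 ?sqr_ge0// mulr_ge0// ltW.
pose V w := b0 ^+ 2 + 2 * (N%:R * gamma ^+ 2) + W w.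
have V0 w : 0 <= V w.
  have : 0 <= N%:R * gamma ^+ 2 by rewrite mulr_ge0 ?sqr_ge0.
  by have := W_ge0 w; have := sqr_ge0 b0; rewrite /V; lra.
have YV w : Y w <= 2 * SX w * Num.sqrt (V w).
  by apply: Y_le; rewrite /V; have := sum_g_le N w; rewrite -/(Y w); lra.
have iV : P.-integrable setT (EFin \o V).
  by apply: integrableDR => //; exact: integrable_cstR.
apply: (@markov_event _ _ _ _
  (fun w => 2 / Q * SX w + B^-1 * V w) _ 3) => //.
- by apply: integrableDR; exact: integrableZR.
- by move=> w; rewrite addr_ge0// mulr_ge0// ?divr_ge0 ?invr_ge0// ltW.
- rewrite RintegralD//; [|exact: integrableZR|exact: integrableZR].
  rewrite !RintegralZl// (_ : 3 = 2 + 1); last by ring.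
  apply: lerD.
    by rewrite mulrAC ler_pdivrMr// ler_wpM2l.
  rewrite ler_pdivrMl// mulr1 RintegralD//; last exact: integrable_cstR.
  rewrite Rintegral_cst_prob /B -addrA lerD2l.
  apply: (le_trans (lerD (lexx _) mean_W)).
  rewrite -subr_ge0 (_ : _ - _ = 2 * N%:R * (gamma ^+ 2 + sigma ^+ 2
    + 4 * gamma * sigma)); last by ring.
  by rewrite mulr_ge0 ?addr_ge0 ?sqr_ge0 ?mulr_ge0.
move=> w hw; apply: (le_trans (Z_le w)).
apply: (first_rate Q_gt0 N_gt0 hb0 tau0 delta_gt0 (SX_ge0 w) (V0 w) (Y_ge0 w) (YV w)).
apply: le_trans hw; rewrite le_eqVlt; apply/orP; left; apply/eqP.
by rewrite -/B mulrCA (mulrC (V w)) mulrA (mulrC _ (SX w)) mulrA.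
Qed.

(** Here Y stays inside the bound on S^2, so that gamma enters only through Q. Markov is applied to
    the sum of X / Q and the normalized W, each of mean at most 1. *)
Lemma adagrad_norm_second_rate : ((1 - delta)%:E <= P [set w |
  (\big[Num.min/l2norm (gradient F (x 0%N w)) ^+ 2]_(k < N)
      l2norm (gradient F (x k w)) ^+ 2 <=
    (8 * Q / delta + 2 * b0) * (4 * Q / (N%:R * delta))
    + 8 * Q * sigma / (delta `^ (3 / 2) * Num.sqrt N%:R))%R])%E.
Proof.
set B := 2 * N%:R * sigma ^+ 2 + delta * b0 ^+ 2.
have db : 0 < delta * b0 ^+ 2 by rewrite mulr_gt0// exprn_gt0.
have B0 : 0 < B by rewrite ltr_wpDl// mulr_ge0 ?sqr_ge0// mulr_ge0// ltW.
pose V w := W w + delta * b0 ^+ 2.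
have iV : P.-integrable setT (EFin \o V).
  by apply: integrableDR => //; exact: integrable_cstR.
apply: (@markov_event _ _ _ _
  (fun w => Q^-1 * SX w + B^-1 * V w) _ 2) => //.
- by apply: integrableDR; exact: integrableZR.
- move=> w; rewrite addr_ge0// mulr_ge0// ?invr_ge0 ?(ltW Q_gt0) ?(ltW B0)//.
  by rewrite addr_ge0// ltW.
- rewrite RintegralD//; [|exact: integrableZR|exact: integrableZR].
  rewrite !RintegralZl// (_ : 2 = 1 + 1); last by ring.
  apply: lerD; rewrite ler_pdivrMl// mulr1//.
  rewrite RintegralD//; last exact: integrable_cstR.
  by rewrite Rintegral_cst_prob lerD2r.
move=> w hw; apply: (le_trans (Z_le w)).
apply: (second_rate Q_gt0 N_gt0 hb0 hsigma hdelta (SX_ge0 w) (W_ge0 w) (Y_ge0 w)).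
  exact: Y_le.
by move: hw; rewrite [Q^-1 * _]mulrC [B^-1 * _]mulrC.
Qed.

End adagrad_bounds.

Theorem theorem2p1 (R : realType) (d m : nat)
    (disp : measure_display) (T : measurableType disp) (P : probability T R)
    (F : 'rV[R]_d -> R) (L : R) (hF : C1L L F) (hFinf : has_lbound (range F))
    (G : 'rV[R]_d -> 'rV[R]_m -> 'rV[R]_d)
    (hG : measurable_fun setT (fun z : 'rV[R]_d * 'rV[R]_m => G z.1 z.2))
    (xi : nat -> {RV P >-> 'rV[R]_m})
    (x0 : 'rV[R]_d) (b0 eta : R) (hb0 : 0 < b0) (heta : 0 < eta)
    (x : nat -> T -> 'rV[R]_d) (b : nat -> T -> R)
    (hxb : adagrad_norm G eta x0 b0 xi x b)
    (sigma gamma : R) (hsigma : 0 <= sigma) (hgamma : 0 <= gamma)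
    (hunbiased : forall k, is_cond_exp_rV P (past xi k)
        (fun w => G (x k w) (xi k w)) (fun w => gradient F (x k w)))
    (hindep : mutually_independent P xi)
    (hindepx : forall k, independent P (xi k) (x k))
    (hvar : forall k, cond_exp_le P (past xi k)
        (fun w => l2norm (G (x k w) (xi k w) - gradient F (x k w)) ^+ 2)
        (sigma ^+ 2))
    (hgrad : forall y, l2norm (gradient F y) ^+ 2 <= gamma ^+ 2)
    (N : nat) (hN : (1 <= N)%N) (delta : R) (hdelta : 0 < delta < 1) :
  let Q := calQ (F x0) (inf (range F)) eta L sigma gamma b0 N in
  ((1 - delta)%:E <= P [set w | (
     \big[Num.min/l2norm (gradient F (x 0%N w)) ^+ 2]_(l < N)
        l2norm (gradient F (x l w)) ^+ 2
     <= Num.min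
          ((2 * b0 / N%:R + 4 * (gamma + sigma) / Num.sqrt N%:R)
             * (Q / delta `^ (3 / 2)))
          ((8 * Q / delta + 2 * b0) * (4 * Q / (N%:R * delta))
             + 8 * Q * sigma / (delta `^ (3 / 2) * Num.sqrt N%:R)))%R])%E.
Proof.
have mxi k : measurable_fun setT (xi k) by exact: measurable_funPT.
have first := adagrad_norm_first_rate hF hFinf hG mxi hb0 heta hxb hsigma hgamma
  hunbiased hvar hgrad hN hdelta.
have second := adagrad_norm_second_rate hF hFinf hG mxi hb0 heta hxb hsigma hgamma
  hunbiased hvar hgrad hN hdelta.
(* The two bounds do not depend on the outcome, so their minimum is one fixed bound among them: a
   single event suffices and no union bound is paid. *)
by lazy zeta; rewrite /Num.min; case: ifP.
Qed.
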